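(* Let $n\ge2$ and let $V,V'$ be nonzero finite-dimensional vector superspaces over $\mathbb F$, each satisfying: (its even dimension is at least $n$ if its odd dimension is $0$) and ($\operatorname{char}\mathbb F=0$ or $\operatorname{char}\mathbb F>n$ if its odd dimension is positive). Write $d_{\bar0},d_{\bar1}$ (resp. $d'_{\bar0},d'_{\bar1}$) for the even and odd dimensions of $V$ (resp. $V'$), $d=d_{\bar0}+d_{\bar1}$, $d'=d'_{\bar0}+d'_{\bar1}$. Let $\mathcal B=\{v_i\}_{i=1}^d$ and $\mathcal B'=\{v'_i\}_{i=1}^{d'}$ be parity-ordered bases of $V$ and $V'$, and let $\{\hat e_I\}_{I\in\widehat{\mathcal I}_n(V)}$ and $\{\hat e'_{I'}\}_{I'\in\widehat{\mathcal I}_n(V')}$ be the associated bases of $\bigwedge^nV$ and $\bigwedge^nV'$. Then: 1) Let $w_1,\dots,w_n\in V$ with $w_j\in V_{\bar0}$ for $j\le r$ and $w_j\in V_{\bar1}$ for $j>r$, for some $0\le r\le\min(d_{\bar0},n)$, and write $w_j=\sum_{i=1}^da_{ij}v_i$, $A=(a_{ij})=\mathrm{diag}(A_{\bar0},A_{\bar1})\in\mathcal M_{d\times n}(\mathbb F)$ (an even supermatrix of type $(d_{\bar0}|d_{\bar1})\times(r|n-r)$). With $J=(1,\dots,n)$, $$\wedge_jw_j=\sum_{I\in\widehat{\mathcal I}_n(V)}\widehat{\mathcal M}_{I,J}(A)\,\hat e_I,$$ where $\widehat{\mathcal M}_{I,J}(A)=0$ if $I\notin\widehat{\mathcal I}^{(r,n-r)}(V)$.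 2) Let $h\colon V\to V'$ be an even linear map with coordinate matrix $A=(a_{ij})=\mathrm{diag}(A_{\bar0},A_{\bar1})\in\mathcal M_{d'\times d}(\mathbb F)$ with respect to $\mathcal B$ and $\mathcal B'$. Then the coordinate matrix of $h^{\wedge n}\colon\bigwedge^nV\to\bigwedge^nV'$, $\wedge_ix_i\mapsto\wedge_ih(x_i)$, in the associated bases is $$A^{\wedge n}:=\big(\widehat{\mathcal M}_{I',I}(A)\big)_{I'\in\widehat{\mathcal I}_n(V'),\,I\in\widehat{\mathcal I}_n(V)}.$$ (Here $\widehat{\mathcal M}_{I',I}(A)=0$ if $I\in\widehat{\mathcal I}^{(r,n-r)}(V)$, $I'\in\widehat{\mathcal I}^{(s,n-s)}(V')$ with $r\ne s$.)
   Context: $\mathbb F$ is a field with $\operatorname{char}\mathbb F\neq2$. Vector superspaces are $\mathbb Z_2$-graded; $\eta_{x,y}=(-1)^{\varepsilon(x)\varepsilon(y)}$ with $\varepsilon$ the parity. A parity-ordered basis lists even basis vectors first, then odd ones. $S_n$ acts on $V^{\otimes n}$ with $(i\ \,i{+}1)$ acting by $v_1\otimes\dots\otimes v_n\mapsto\eta_{v_i,v_{i+1}}v_1\otimes\dots\otimes v_{i+1}\otimes v_i\otimes\dots\otimes v_n$; $\bigwedge^nV$ is the quotient of $V^{\otimes n}$ by the span of all $v-\mathrm{sgn}(\sigma)\sigma\cdot v$, and $\wedge_iv_i=v_1\wedge\dots\wedge v_n$ is the class of $\otimes_iv_i$. $\widehat{\mathcal I}^{(k,n-k)}(V)$ ($0\le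 k\le\min(d_{\bar0},n)$) is the set of tuples $I=(i_1,\dots,i_n)$ with $1\le i_1<\dots<i_k\le d_{\bar0}<i_{k+1}\le\dots\le i_n\le d$, and $\widehat{\mathcal I}_n(V)$ is their union over $k$. $\hat e_I=v_{i_1}\wedge\dots\wedge v_{i_n}$; under the stated hypotheses these form a basis of $\bigwedge^nV$. For $I\in\widehat{\mathcal I}^{(k,n-k)}(V)$ and $\sigma\in S_n$, $\widehat{\mathrm{sgn}}_{k,n-k}(\sigma)\in\{\pm1\}$ is the sign defined by $v_{i_1}\wedge\dots\wedge v_{i_n}=\widehat{\mathrm{sgn}}_{k,n-k}(\sigma)\,v_{i_{\sigma(1)}}\wedge\dots\wedge v_{i_{\sigma(n)}}$ (it is determined by the relations $x\wedge y=-\eta_{x,y}y\wedge x$). $S_n(I)\subseteq S_n$ denotes a set of permutations such that $(i_{\sigma(1)},\dots,i_{\sigma(n)})$, $\sigma\in S_n(I)$, runs through each distinct rearrangement of $I$ exactly once. For $I=(i_1,\dots,i_n)\in\widehat{\mathcal I}^{(p,n-p)}$ (row indices), $J=(j_1,\dots,j_n)$ (column indices, listed with even columns first, increasing on even and weakly increasing on odd ones) and an even (block diagonal) supermatrix $A=(a_{ij})$, the alternating $(I,J)$-superminor is $$\widehat{\mathcal M}_{I,J}(A)=\sum_{\sigma\in S_n(I)}\widehat{\mathrm{sgn}}_{p,n-p}(\sigma)\prod_{t=1}^na_{i_{\sigma(t)},j_t}.$$ *)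

(* Defs.v *)
From HB Require Import structures.
From mathcomp Require Import all_boot all_fingroup all_algebra.
From mathcomp Require Import zify.

Set Implicit Arguments.
Unset Strict Implicit.
Unset Printing Implicit Defensive.

Import GRing.Theory.
Local Open Scope ring_scope.
Local Open Scope quotient_scope.

(* The library only makes the quotient {quot K} a Z-module; when K is a       *)
(* subspace we add its F-linear and finite-dimensional structures.            *)
Section VectorQuotient.

Variables (F : fieldType) (T : vectType F) (K : {vspace T}).

Definition vquot : Type := Quotient.quot K.

HB.instance Definition _ := GRing.Zmodule.on vquot.

Definition vquot_pi (x : T) : vquot := \pi_(Quotient.quot K) x.
Definition vquot_repr (q : vquot) : T :=
  generic_quotient.repr (q : Quotient.quot K).

Lemma vquot_reprK : cancel vquot_repr vquot_pi.
Proof. by move=> q; rewrite /vquot_pi /vquot_repr reprK. Qed.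

Lemma vquot_piP x y : (vquot_pi x == vquot_pi y) = (x - y \in K).
Proof. by rewrite Quotient.idealrBE. Qed.

Definition vquot_scale (a : F) (q : vquot) : vquot :=
  vquot_pi (a *: vquot_repr q).

Lemma vquot_piD x y : vquot_pi (x + y) = vquot_pi x + vquot_pi y.
Proof. by rewrite /vquot_pi !piE. Qed.

Lemma vquot_piZ a x : vquot_pi (a *: x) = vquot_scale a (vquot_pi x).
Proof.
apply/eqP; rewrite vquot_piP -scalerBr memvZ // -vquot_piP.
by rewrite vquot_reprK.
Qed.

Fact vquot_scaleA a b q :
  vquot_scale a (vquot_scale b q) = vquot_scale (a * b) q.
Proof. by rewrite -[q]vquot_reprK -!vquot_piZ scalerA. Qed.

Fact vquot_scale1 : left_id 1 vquot_scale.
Proof. by move=> q; rewrite -[q]vquot_reprK -vquot_piZ scale1r. Qed.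

Fact vquot_scaleDr : right_distributive vquot_scale +%R.
Proof.
move=> a p q; rewrite -[p]vquot_reprK -[q]vquot_reprK.
by rewrite -vquot_piD -!vquot_piZ scalerDr vquot_piD.
Qed.

Fact vquot_scaleDl q : {morph vquot_scale^~ q : a b / a + b}.
Proof.
by move=> a b; rewrite -[q]vquot_reprK -!vquot_piZ scalerDl vquot_piD.
Qed.

HB.instance Definition _ := GRing.Zmodule_isLmodule.Build F vquot
  vquot_scaleA vquot_scale1 vquot_scaleDr vquot_scaleDl.

Fact vquot_pi_linear : linear vquot_pi.
Proof. by move=> a x y; rewrite vquot_piD vquot_piZ. Qed.
HB.instance Definition _ :=
  GRing.isLinear.Build F T vquot _ vquot_pi vquot_pi_linear.

Lemma vquot_pi_eq0 x : (vquot_pi x == 0) = (x \in K).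
Proof. by rewrite -[0](raddf0 vquot_pi) vquot_piP subr0. Qed.

Fact vquot_vect_iso : Vector.axiom (\dim (K^C)) vquot.
Proof.
have pi0 x : x \in K -> daddv_pi (K^C) K x = 0.
  move=> Kx; have KC0 : (K :&: K^C = 0)%VS by rewrite capv_compl.
  have := daddv_pi_add KC0 (subvP (addvSl K (K^C)) _ Kx).
  rewrite daddv_pi_id // => /eqP; rewrite -subr_eq0 addrC addKr.
  by move/eqP.
pose g (q : vquot) : subvs_of (K^C)%VS :=
  vsproj (K^C) (daddv_pi (K^C) K (vquot_repr q)).
have gpi x : g (vquot_pi x) = vsproj (K^C) (daddv_pi (K^C) K x).
  apply/eqP; rewrite -subr_eq0 -!raddfB /= pi0 ?raddf0 //.
  by rewrite -vquot_piP vquot_reprK.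
have g_lin : linear g.
  move=> a p q; rewrite -[p]vquot_reprK -[q]vquot_reprK -linearP !gpi.
  by rewrite !linearP.
pose h (w : subvs_of (K^C)%VS) : vquot := vquot_pi (vsval w).
have gh : cancel h g.
  move=> w; rewrite /h gpi daddv_pi_id ?vsvalK ?subvsP //.
  by rewrite capvC capv_compl.
have hg : cancel g h.
  move=> q; rewrite -[q]vquot_reprK gpi /h vsprojK ?memv_pi //.
  apply/eqP; rewrite vquot_piP; set x := vquot_repr q.
  have KC0 : (K :&: K^C = 0)%VS by rewrite capv_compl.
  have xf : x \in (K + K^C)%VS by rewrite addv_complf memvf.
  by rewrite -{2}(daddv_pi_add KC0 xf) opprD addrCA subrr addr0 rpredN memv_pi.
have [f f_lin f_bij] := subvs_vect_iso (K^C)%VS.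
exists (f \o g); first by move=> a p q; rewrite /= g_lin f_lin.
by apply: bij_comp => //; exists h.
Qed.
HB.instance Definition _ := Lmodule_hasFinDim.Build F vquot vquot_vect_iso.

End VectorQuotient.

(* Parity is a boolean: false is even and true is odd. *)
Record superspace (F : fieldType) := Superspace {
  superspace_sort :> vectType F;
  even_part : {vspace superspace_sort};
  odd_part : {vspace superspace_sort};
  superspace_direct : directv (even_part + odd_part);
  superspace_full : (even_part + odd_part = fullv)%VS }.

Section SuperspaceTheory.

Variables (F : fieldType) (V : superspace F).

Definition spart (b : bool) : {vspace V} :=
  if b then odd_part V else even_part V.

Definition edim : nat := \dim (even_part V).
Definition odim : nat := \dim (odd_part V).
Definition sdim : nat := (edim + odim)%N.

Definition parity_ordered_basis (v : sdim.-tuple V) :=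
  basis_of fullv v /\ forall i : 'I_sdim, tnth v i \in spart (edim <= i)%N.

Definition homog_basis : sdim.-tuple V :=
  [tuple of vbasis (even_part V) ++ vbasis (odd_part V)].

Lemma homog_basisP : parity_ordered_basis homog_basis.
Proof.
split.
  rewrite -superspace_full; apply: cat_basis (vbasisP _) (vbasisP _).
  exact: superspace_direct.
move=> i; rewrite (tnth_nth 0) /= nth_cat size_tuple -/edim.
case: (ltnP i edim) => [lt_i|le_i] /=.
  by apply: vbasis_mem; rewrite mem_nth ?size_tuple.
by apply: vbasis_mem; rewrite mem_nth // size_tuple ltn_subLR.
Qed.

Lemma coord_homog (v : sdim.-tuple V) (hv : parity_ordered_basis v) b x
    (i : 'I_sdim) :
  x \in spart b -> (edim <= i)%N != b -> coord v i x = 0.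
Proof.
case: hv => v_basis v_par xb ib.
have [c ->] : exists c : 'I_sdim -> F,
    x = \sum_(j : 'I_sdim | (edim <= j)%N == b) c j *: v`_j; last first.
  rewrite linear_sum big1 // => j /eqP jb; rewrite linearZ /=.
  rewrite coord_free ?(basis_free v_basis) //.
  by case: (eqVneq j i) ib => [<-|]; rewrite ?mulr0 // jb eqxx.
pose y b' := \sum_(j : 'I_sdim | (edim <= j)%N == b') coord v j x *: v`_j.
have yP b' : y b' \in spart b'.
  apply: memv_suml => j /eqP jb'; apply: memvZ; rewrite -tnth_nth -jb'.
  exact: v_par.
have xE : x = y b + y (~~ b).
  rewrite [LHS](coord_basis v_basis) ?memvf //.
  rewrite (bigID (fun j : 'I_sdim => (edim <= j)%N == b)) /=.
  by congr (_ + _); apply: eq_bigl => j; case: (_ <= _)%N; case: (b).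
have cap0 : (spart b :&: spart (~~ b) = 0)%VS.
  have c0 := directv_addP (superspace_direct V).
  by case: (b) => //=; rewrite capvC.
exists (fun j => coord v j x); rewrite -[RHS]/(y b) {1}xE.
have yx : y (~~ b) = x - y b by apply/esym/eqP; rewrite subr_eq [eqbRHS]addrC -xE.
have : y (~~ b) \in (spart b :&: spart (~~ b))%VS.
  by rewrite memv_cap yP andbT yx rpredB.
by rewrite cap0 memv0 => /eqP ->; rewrite addr0.
Qed.

End SuperspaceTheory.

Definition even_hom (F : fieldType) (V W : superspace F) (h : 'Hom(V, W)) :=
  forall b, (h @: spart V b <= spart W b)%VS.

Section TensorPower.

Variables (F : fieldType) (V : superspace F) (n : nat).

Local Notation d := (sdim V).
Local Notation b := (homog_basis V).

(* The n-th tensor power, in coordinates: a tensor is stored as its family of *)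
(* coefficients on the b_(f 0) (x) ... (x) b_(f (n-1)), with b a fixed        *)
(* homogeneous basis of V. See tensor_universal for the universal property.   *)
Definition tpower : vectType F := {ffun {ffun 'I_n -> 'I_d} -> F^o}.

Definition tens (x : 'I_n -> V) : tpower :=
  [ffun f : {ffun 'I_n -> 'I_d} => \prod_t coord b (f t) (x t)].

Definition update (x : {ffun 'I_n -> V}) (i : 'I_n) (y : V) :
    {ffun 'I_n -> V} :=
  [ffun t => if t == i then y else x t].

Definition multilinear (W : lmodType F) (phi : {ffun 'I_n -> V} -> W) :=
  forall x i a y z,
    phi (update x i (a *: y + z)) =
    a *: phi (update x i y) + phi (update x i z).

Lemma multilinear_ext (W : lmodType F) (phi psi : {ffun 'I_n -> V} -> W) :
  multilinear phi -> multilinear psi ->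
  (forall f : {ffun 'I_n -> 'I_d},
    phi [ffun t => tnth b (f t)] = psi [ffun t => tnth b (f t)]) ->
  phi =1 psi.
Proof.
move=> phiM psiM phi_psi x.
have lin_sum (chi : {ffun 'I_n -> V} -> W) z i (c : 'I_d -> F) :
    multilinear chi ->
    chi (update z i (\sum_j c j *: tnth b j)) =
    \sum_j c j *: chi (update z i (tnth b j)).
  move=> chiM; have chi0 : chi (update z i 0) = 0.
    have /eqP := chiM z i (-1) 0 0.
    by rewrite scaler0 addr0 scaleN1r addNr => /eqP.
  elim/big_rec2: _ => [//|j u y _ IH]; by rewrite chiM IH.
pose isb (y : V) := [exists j, y == tnth b j].
pose nb (y : {ffun 'I_n -> V}) := #|[set t | ~~ isb (y t)]|.
move: {2}(nb x) (leqnn (nb x)) => m; elim: m x => [|m IHm] x.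
  rewrite leqn0 cards_eq0 => /eqP x0.
  have xb t : exists j, x t = tnth b j.
    by have := in_set0 t; rewrite -x0 inE => /negbFE/existsP[j /eqP]; exists j.
  have [f fP] := fin_all_exists xb.
  have -> : x = [ffun t => tnth b ([ffun t => f t] t)].
    by apply/ffunP=> t; rewrite !ffunE.
  exact: phi_psi.
have [x0 _|[i]] := set_0Vmem [set t | ~~ isb (x t)].
  by apply: IHm; rewrite /nb x0 cards0.
rewrite inE => xi nbx.
have -> : x = update x i (\sum_j coord b j (x i) *: tnth b j).
  apply/ffunP=> t; rewrite ffunE; case: eqP => // ->.
  rewrite [LHS](coord_basis (homog_basisP V).1) ?memvf //.
  by apply: eq_bigr => j _; rewrite -tnth_nth.
rewrite !lin_sum //; apply: eq_bigr => j _; congr (_ *: _); apply: IHm.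
rewrite -ltnS; apply: leq_trans nbx; apply: proper_card; apply/properP; split.
  apply/subsetP=> t; rewrite !inE ffunE; case: eqP => // _ /existsP[].
  by exists j.
exists i; rewrite inE // ffunE eqxx negbK; apply/existsP; by exists j.
Qed.

Lemma tens_ext (x y : 'I_n -> V) : x =1 y -> tens x = tens y.
Proof.
by move=> xy; apply/ffunP=> f; rewrite !ffunE; apply: eq_bigr => t _; rewrite xy.
Qed.

Lemma tens_multilinear : multilinear (fun x => tens x).
Proof.
move=> x i a y z; apply/ffunP=> f; rewrite !ffunE.
have updE u : \prod_t coord b (f t) (update x i u t) =
    coord b (f i) u * \prod_(t | t != i) coord b (f t) (x t).
  rewrite (bigD1 i) //= ffunE eqxx; congr (_ * _).
  by apply: eq_bigr => t /negbTE ti; rewrite ffunE ti.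
by rewrite !updE linearP mulrDl -mulrA.
Qed.

Lemma tens_basis (f : {ffun 'I_n -> 'I_d}) :
  tens (fun t => tnth b (f t)) = [ffun g => (g == f)%:R].
Proof.
apply/ffunP=> g; rewrite !ffunE.
have [->|/eqP gf] := eqVneq g f.
  rewrite big1 // => t _.
  by rewrite (tnth_nth 0) coord_free ?(basis_free (homog_basisP V).1) // eqxx.
have /existsP[t gt] : [exists t, g t != f t].
  rewrite -negb_forall; apply/forallP=> gfE; apply: gf.
  by apply/ffunP=> t; apply/eqP.
rewrite (bigD1 t) //= (tnth_nth 0).
rewrite coord_free ?(basis_free (homog_basisP V).1) //.
by rewrite eq_sym (negbTE gt) mul0r.
Qed.

Lemma tensor_basisE (T : tpower) :
  T = \sum_f (T f : F) *: tens (fun t => tnth b (f t)).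
Proof.
apply/ffunP=> g; rewrite sum_ffunE (bigD1 g) //= big1 ?addr0 => [|f fg].
  by rewrite ffunE tens_basis ffunE eqxx /GRing.scale /= mulr1.
by rewrite ffunE tens_basis ffunE eq_sym (negbTE fg) scaler0.
Qed.

Lemma tensor_universal (W : lmodType F) (phi : {ffun 'I_n -> V} -> W) :
  multilinear phi ->
  exists g : {linear tpower -> W},
    (forall x : {ffun 'I_n -> V}, g (tens x) = phi x) /\
    (forall g' : {linear tpower -> W},
      (forall x : {ffun 'I_n -> V}, g' (tens x) = phi x) -> g' =1 g).
Proof.
move=> phiM.
pose g (T : tpower) :=
  \sum_f (T f : F) *: phi [ffun t => tnth b (f t)].
have g_lin : linear g.
  move=> a T U; rewrite /g scaler_sumr -big_split /=; apply: eq_bigr => f _.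
  by rewrite !ffunE scalerDl scalerA.
pose gL : {linear tpower -> W} := HB.pack g (GRing.isLinear.Build _ _ _ _ g g_lin).
have ext (k1 k2 : {linear tpower -> W}) :
    (forall x : {ffun 'I_n -> V}, k1 (tens x) = k2 (tens x)) -> k1 =1 k2.
  move=> k12 T; rewrite (tensor_basisE T) !linear_sum; apply: eq_bigr => f _.
  rewrite !linearZ /=; congr (_ *: _).
  have -> : tens (fun t => tnth b (f t)) = tens [ffun t => tnth b (f t)].
    by apply: tens_ext => t; rewrite ffunE.
  exact: k12.
have gP (x : {ffun 'I_n -> V}) : gL (tens x) = phi x.
  move: x; apply: multilinear_ext => // [x i a y z | f] /=.
    by rewrite tens_multilinear g_lin.
  rewrite /g (bigD1 f) //= big1 ?addr0 => [|h hf].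
    rewrite (@tens_ext _ (fun t => tnth b (f t))) => [|t]; last by rewrite ffunE.
    by rewrite tens_basis ffunE eqxx scale1r.
  rewrite (@tens_ext _ (fun t => tnth b (f t))) => [|t]; last by rewrite ffunE.
  by rewrite tens_basis ffunE (negbTE hf) scale0r.
by exists gL; split=> // g' g'P; apply: ext => x; rewrite g'P gP.
Qed.

(* The sign picked up when s permutes tensor factors of parities p: each pair *)
(* of odd factors whose order is reversed contributes -1.                     *)
Definition koszul (p : 'I_n -> bool) (s : 'S_n) : F :=
  \prod_(q : 'I_n * 'I_n | (q.1 < q.2)%N && (s q.2 < s q.1)%N)
    (-1) ^+ (p q.1 && p q.2).

(* b_f is sent to koszul(f, s) b_(f o s^-1); see tact_homog. Permutations     *)
(* compose from left to right in the library: (s * t) i = t (s i).            *)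
Definition tact_fun (s : 'S_n) (T : tpower) : tpower :=
  [ffun g : {ffun 'I_n -> 'I_d} =>
    koszul (fun t => edim V <= g (s t))%N s * T [ffun t => g (s t)]].

Fact tact_linear s : linear (tact_fun s).
Proof.
move=> a T U; apply/ffunP=> g; rewrite !ffunE mulrDr; congr (_ + _).
by rewrite /GRing.scale /= mulrCA.
Qed.
HB.instance Definition _ s :=
  GRing.isLinear.Build F tpower tpower _ (tact_fun s) (tact_linear s).

Definition tact (s : 'S_n) : 'End(tpower) := linfun (tact_fun s).

Lemma koszul1 p : koszul p 1%g = 1.
Proof.
by rewrite /koszul big1 // => q; rewrite !perm1 => /andP[/ltnW]; rewrite leqNgt => /negP.
Qed.

Let kpair (p : 'I_n -> bool) (s : 'S_n) (i j : 'I_n) : F :=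
  if (i < j)%N (+) (s i < s j)%N then (-1) ^+ (p i && p j) else 1.

Let kpairC p s i j : i != j -> kpair p s i j = kpair p s j i.
Proof.
move=> ij; have sij : s i != s j by rewrite (inj_eq perm_inj).
have lt_neg (k l : 'I_n) : k != l -> (k < l)%N = ~~ (l < k)%N.
  by rewrite -val_eqE /= => kl; rewrite -leqNgt ltn_neqAle kl.
rewrite /kpair (andbC (p i)) (lt_neg _ _ ij) (lt_neg _ _ sij).
by rewrite addbN addNb negbK.
Qed.

Let koszulE p s :
  koszul p s = \prod_(q : 'I_n * 'I_n | (q.1 < q.2)%N) kpair p s q.1 q.2.
Proof.
rewrite /koszul big_mkcondr /=; apply: eq_bigr => q q12.
have sq : s q.1 != s q.2 by rewrite (inj_eq perm_inj) -val_eqE neq_ltn q12.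
rewrite /kpair q12 addTb -leqNgt ltn_neqAle; move: sq; rewrite -val_eqE /=.
by rewrite eq_sym => ->.
Qed.

Let reindex_pairs (H : 'I_n -> 'I_n -> F) (s : 'S_n) :
  (forall i j, i != j -> H i j = H j i) ->
  \prod_(q : 'I_n * 'I_n | (q.1 < q.2)%N) H (s q.1) (s q.2) =
  \prod_(q : 'I_n * 'I_n | (q.1 < q.2)%N) H q.1 q.2.
Proof.
move=> Hsym; pose P (q : 'I_n * 'I_n) := (q.1 < q.2)%N.
pose Q (q : 'I_n * 'I_n) := ((s^-1)%g q.1 < (s^-1)%g q.2)%N.
have -> : \prod_(q | P q) H (s q.1) (s q.2) = \prod_(q | Q q) H q.1 q.2.
  pose g (q : 'I_n * 'I_n) := (s q.1, s q.2).
  rewrite [RHS](reindex_inj (h := g)) /=; last first.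
    by move=> [i j] [i' j'] [/perm_inj -> /perm_inj ->].
  by apply: eq_bigl => q; rewrite /Q /P /g /= !permK.
rewrite (bigID P) [RHS](bigID Q) /=; congr (_ * _).
  by apply: eq_bigl => q; rewrite andbC.
pose g (q : 'I_n * 'I_n) := (q.2, q.1).
rewrite (reindex_inj (h := g)) /=; last by move=> [i j] [i' j'] [-> ->].
have PQ i j : Q (j, i) && ~~ P (j, i) = P (i, j) && ~~ Q (i, j).
  have [<-|ij] := eqVneq i j; first by rewrite /P /Q /= !ltnn.
  have lt_neg (k l : 'I_n) : k != l -> ~~ (l < k)%N = (k < l)%N.
    by rewrite -val_eqE /= => kl; rewrite -leqNgt [in RHS]ltn_neqAle kl.
  have sji : (s^-1)%g j != (s^-1)%g i by rewrite (inj_eq perm_inj) eq_sym.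
  by rewrite /P /Q /= (lt_neg _ _ ij) (lt_neg _ _ sji) andbC.
apply: eq_big => [[i j]|[i j]]; first exact: PQ.
rewrite /g /= PQ => /andP[ltij _]; apply: Hsym.
by rewrite -val_eqE eq_sym neq_ltn; move: ltij; rewrite /P /= => ->.
Qed.

Lemma koszulM p (s t : 'S_n) :
  koszul p (s * t)%g = koszul p s * koszul (fun i => p ((s^-1)%g i)) t.
Proof.
set p' := fun i => _.
rewrite !koszulE -(@reindex_pairs (kpair p' t) s) -?big_split /=; last first.
  by move=> i j; apply: kpairC.
apply: eq_bigr => q _; rewrite /kpair /p' !permK !permM.
have := sqrr_sign F (p q.1 && p q.2); rewrite expr2.
by do 3!case: (_ < _)%N; rewrite /= ?mulr1 ?mul1r.
Qed.

Lemma tact1 T : tact 1%g T = T.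
Proof.
rewrite lfunE; apply/ffunP=> g; rewrite ffunE koszul1 mul1r.
by congr (T _); apply/ffunP=> t; rewrite ffunE perm1.
Qed.

Lemma tactM (s t : 'S_n) T : tact (s * t)%g T = tact t (tact s T).
Proof.
rewrite !lfunE; apply/ffunP=> g; rewrite !ffunE koszulM mulrA; congr (_ * T _).
  rewrite mulrC; congr (_ * _); apply: eq_bigr => q _; first by rewrite !permM !permKV.
  by rewrite !ffunE !permM.
by apply/ffunP=> i; rewrite !ffunE permM.
Qed.

Lemma tact_homog (p : 'I_n -> bool) (x : 'I_n -> V) (s : 'S_n) :
  (forall t, x t \in spart V (p t)) ->
  tact s (tens x) = koszul p s *: tens (fun t => x ((s^-1)%g t)).
Proof.
move=> xp; rewrite lfunE; apply/ffunP=> g; rewrite !ffunE.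
have -> : \prod_t coord b ([ffun t => g (s t)] t) (x t) =
          \prod_t coord b (g t) (x ((s^-1)%g t)).
  rewrite [RHS](reindex_inj (@perm_inj _ s)) /=.
  by apply: eq_bigr => t _; rewrite ffunE permK.
rewrite /GRing.scale /=; have [/forallP gp|] :=
  boolP [forall t, (edim V <= g (s t))%N == p t].
  by congr (_ * _); apply: eq_bigr => q _; rewrite !(eqP (gp _)).
rewrite negb_forall => /existsP[t gt].
rewrite (bigD1 (s t)) //= permK (coord_homog (homog_basisP V) (xp t)) //.
by rewrite mul0r !mulr0.
Qed.

Lemma tact_adjacent (p : 'I_n -> bool) (x : 'I_n -> V) (i j : 'I_n) :
  j = i.+1 :> nat -> (forall t, x t \in spart V (p t)) ->
  tact (tperm i j) (tens x) =
  (-1) ^+ (p i && p j) *: tens (fun t => x (tperm i j t)).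
Proof.
move=> ji xp; rewrite (tact_homog _ xp) tpermV; congr (_ *: _).
have ij : (i < j)%N by rewrite ji.
rewrite /koszul (big_pred1 (i, j)) // => [[k l]] /=; rewrite xpair_eqE.
rewrite -!val_eqE /=.
have neq (u v : 'I_n) : u <> v -> (u : nat) <> v by move=> uv /val_inj.
by case: (tpermP i j k) => [->|->|/neq ki /neq kj];
  case: (tpermP i j l) => [->|->|/neq li /neq lj]; lia.
Qed.

(* The span of all T - sgn(s) s.T *)
Definition ext_rel : {vspace tpower} :=
  (\sum_(s : 'S_n) limg (\1%VF - (-1) ^+ s *: tact s)%R)%VS.

Lemma ext_rel_mem (s : 'S_n) T : T - (-1) ^+ s *: tact s T \in ext_rel.
Proof.
rewrite /ext_rel (bigD1 s) //=; apply: subvP (addvSl _ _) _ _.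
have -> : T - (-1) ^+ s *: tact s T = (\1%VF - (-1) ^+ s *: tact s) T.
  by rewrite add_lfunE opp_lfunE scale_lfunE id_lfunE.
exact: memv_img (memvf _).
Qed.

Definition extpow : vectType F := vquot ext_rel.

Definition wedge (x : 'I_n -> V) : extpow := vquot_pi ext_rel (tens x).

Lemma wedge_perm (s : 'S_n) (p : 'I_n -> bool) (x : 'I_n -> V) :
  (forall t, x t \in spart V (p t)) ->
  wedge x = ((-1) ^+ s * koszul p s) *: wedge (fun t => x ((s^-1)%g t)).
Proof.
move=> xp; rewrite -linearZ; apply/eqP; rewrite vquot_piP.
by rewrite -scalerA -(tact_homog s xp) ext_rel_mem.
Qed.

End TensorPower.

Arguments tact {F V n} s.

Section ExteriorMap.

Variables (F : fieldType) (V W : superspace F) (n : nat) (h : 'Hom(V, W)).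

Definition tpower_map_fun (T : tpower V n) : tpower W n :=
  \sum_(f : {ffun 'I_n -> 'I_(sdim V)})
     (T f : F) *: tens (fun t => h (tnth (homog_basis V) (f t))).

Fact tpower_map_linear : linear tpower_map_fun.
Proof.
move=> a T U; rewrite /tpower_map_fun scaler_sumr -big_split /=.
by apply: eq_bigr => f _; rewrite !ffunE scalerDl scalerA.
Qed.
HB.instance Definition _ :=
  GRing.isLinear.Build F (tpower V n) (tpower W n) _ tpower_map_fun
    tpower_map_linear.

Lemma tpower_map_tens (x : 'I_n -> V) :
  tpower_map_fun (tens x) = tens (fun t => h (x t)).
Proof.
apply/ffunP=> g; rewrite sum_ffunE ffunE.
pose c (t : 'I_n) j := coord (homog_basis V) j (x t) *
  coord (homog_basis W) (g t) (h (tnth (homog_basis V) j)).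
transitivity (\prod_t \sum_j c t j).
  rewrite bigA_distr_bigA /=; apply: eq_bigr => f _.
  by rewrite !ffunE /GRing.scale /= -big_split.
apply: eq_bigr => t _; rewrite [in RHS](coord_basis (homog_basisP V).1 (memvf (x t))).
rewrite !linear_sum; apply: eq_bigr => j _.
by rewrite !linearZ /= -tnth_nth.
Qed.

Lemma tpower_map_rel T :
  even_hom h -> T \in ext_rel V n -> tpower_map_fun T \in ext_rel W n.
Proof.
move=> h_even /memv_sumP[u uP ->]; rewrite linear_sum; apply: memv_suml => s _.
have /memv_imgP[U _ ->] := uP s isT.
rewrite add_lfunE opp_lfunE scale_lfunE id_lfunE linearB linearZ /=.
have -> : tpower_map_fun (tact s U) = tact s (tpower_map_fun U).
  rewrite {1}(tensor_basisE U) !linear_sum; apply: eq_bigr => f _.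
  rewrite !linearZ /=; congr (_ *: _).
  have fP t : tnth (homog_basis V) (f t) \in spart V (edim V <= f t)%N.
    exact: (homog_basisP V).2.
  have hfP t : h (tnth (homog_basis V) (f t)) \in spart W (edim V <= f t)%N.
    by apply: subvP (h_even _) _ _; apply: memv_img.
  by rewrite (tact_homog s fP) linearZ /= tpower_map_tens (tact_homog s hfP).
exact: ext_rel_mem.
Qed.

(* Only meaningful when h is even: see extpow_map_wedge. *)
Definition extpow_map : 'Hom(extpow V n, extpow W n) :=
  linfun (fun q => vquot_pi (ext_rel W n)
                     (tpower_map_fun (@vquot_repr _ _ (ext_rel V n) q))).

Lemma extpow_map_wedge (x : 'I_n -> V) :
  even_hom h -> extpow_map (wedge x) = wedge (fun t => h (x t)).
Proof.
move=> h_even; set k := fun q => _.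
pose kfun := (fun q => vquot_pi (ext_rel W n)
   (tpower_map_fun (@vquot_repr _ _ (ext_rel V n) q))).
have kpi T : kfun (vquot_pi _ T) = vquot_pi _ (tpower_map_fun T).
  apply/eqP; rewrite vquot_piP -linearB; apply: tpower_map_rel => //.
  by rewrite -vquot_piP vquot_reprK.
have k_lin : linear kfun.
  move=> a p q; rewrite -[p]vquot_reprK -[q]vquot_reprK -linearP !kpi.
  by rewrite !linearP.
pose kL : {linear extpow V n -> extpow W n} :=
  HB.pack kfun (GRing.isLinear.Build _ _ _ _ kfun k_lin).
by rewrite /extpow_map (lfunE kL) /= kpi tpower_map_tens.
Qed.

End ExteriorMap.

(* S is a set S_n(I): the I o s, for s in S, run exactly once through the      *)
(* distinct rearrangements of I.                                              *)
Definition rearrangement_reps (n d : nat) (I : {ffun 'I_n -> 'I_d})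
    (S : {set 'S_n}) :=
  {in S &, injective (fun s : 'S_n => [ffun t => I (s t)])} /\
  forall s : 'S_n,
    exists2 s', s' \in S & [ffun t => I (s' t)] = [ffun t => I (s t)].

(* Indices are 0-based: the even basis vectors are those of index < d0. *)
Section Superminors.

Variables (d0 d1 n : nat).

Local Notation d := (d0 + d1)%N.

Definition hatI_type (k : nat) : {set {ffun 'I_n -> 'I_d}} :=
  [set I : {ffun 'I_n -> 'I_d} |
    [&& (k <= minn d0 n)%N,
        [forall s : 'I_n, ((I s < d0) == (s < k))%N],
        [forall s : 'I_n, forall t : 'I_n,
           ((s < t) && (t < k) ==> (I s < I t))%N] &
        [forall s : 'I_n, forall t : 'I_n,
           ((k <= s) && (s < t) ==> (I s <= I t))%N]]].

Definition hatI : {set {ffun 'I_n -> 'I_d}} :=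
  \bigcup_(k < (minn d0 n).+1) hatI_type k.

Variable F : fieldType.

(* Reordering v_(i_1) /\ ... /\ v_(i_n) into v_(i_s(1)) /\ ... /\ v_(i_s(n))  *)
(* applies s^-1 to the factors, the first k of which are even; see sgn_hatP.  *)
Definition sgn_hat (k : nat) (s : 'S_n) : F :=
  (-1) ^+ s * koszul F (fun t : 'I_n => (k <= t)%N) (s^-1)%g.

(* S stands for S_n(I). For I in hatI_type k the cardinal below is k, see     *)
(* card_even_hatI.                                                            *)
Definition superminor (c : nat) (S : {set 'S_n}) (I : {ffun 'I_n -> 'I_d})
    (J : {ffun 'I_n -> 'I_c}) (A : 'M[F]_(d, c)) : F :=
  \sum_(s in S) sgn_hat #|[set t | (I t < d0)%N]| s *
    \prod_(t < n) A (I (s t)) (J t).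

End Superminors.

Arguments superminor d0 d1 {n F c} S I J A.

(* diag(A_0, A_1) with A_0 of size m0 x c0 *)
Definition even_supermx (F : fieldType) (m c : nat) (m0 c0 : nat)
    (A : 'M[F]_(m, c)) :=
  forall (i : 'I_m) (j : 'I_c), (i < m0)%N != (j < c0)%N -> A i j = 0.

(* Column j holds the coordinates of f(e_j). *)
Definition coordmx (F : fieldType) (U W : vectType F) (m k : nat)
    (e : m.-tuple U) (e' : k.-tuple W) (f : 'Hom(U, W)) : 'M[F]_(k, m) :=
  \matrix_(i, j) coord e' i (f (tnth e j)).

Section AssociatedBasis.

Variables (F : fieldType) (V : superspace F) (n : nat).

Definition hatIV := hatI (edim V) (odim V) n.

Definition hat_e (v : (sdim V).-tuple V) (I : {ffun 'I_n -> 'I_(sdim V)}) :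
  extpow V n := wedge (fun t => tnth v (I t)).

Definition hat_basis (v : (sdim V).-tuple V) : #|hatIV|.-tuple (extpow V n) :=
  [tuple hat_e v (enum_val i) | i < #|hatIV|].

Lemma sgn_hatP (v : (sdim V).-tuple V) (k : nat) I (s : 'S_n) :
  parity_ordered_basis v -> I \in hatI_type (edim V) (odim V) n k ->
  hat_e v I = sgn_hat F k s *: hat_e v [ffun t => I (s t)].
Proof.
move=> [_ v_par]; rewrite inE => /and4P[_ /forallP Ik _ _].
have par t : tnth v (I t) \in spart V (k <= t)%N.
  by rewrite leqNgt -(eqP (Ik t)) -leqNgt.
rewrite /hat_e (wedge_perm (s^-1)%g par) odd_permV.
by congr (_ *: vquot_pi _ _); apply: tens_ext => t; rewrite ffunE invgK.
Qed.

Lemma card_even_hatI k (I : {ffun 'I_n -> 'I_(sdim V)}) :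
  I \in hatI_type (edim V) (odim V) n k -> #|[set t | (I t < edim V)%N]| = k.
Proof.
rewrite inE => /and4P[kn /forallP Ik _ _].
have {}kn : (k <= n)%N by move: kn; rewrite leq_min => /andP[].
rewrite -[RHS](card_ord k) -(@card_imset _ _ (widen_ord kn)); last first.
  by move=> a b /(congr1 val) /= ab; apply: val_inj.
apply: eq_card => t; rewrite inE (eqP (Ik t)); apply/idP/imsetP => [tk|[u _ ->]].
  by exists (Ordinal tk) => //; apply: val_inj.
by rewrite /= ltn_ord.
Qed.

End AssociatedBasis.

Definition extpow_mx (F : fieldType) (V W : superspace F) (n : nat)
    (S : {ffun 'I_n -> 'I_(sdim W)} -> {set 'S_n})
    (A : 'M[F]_(sdim W, sdim V)) : 'M[F]_(#|hatIV W n|, #|hatIV V n|) :=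
  \matrix_(i, j)
    superminor (edim W) (odim W) (S (enum_val i)) (enum_val i) (enum_val j) A.

Definition extpow_cond (F : fieldType) (n : nat) (V : superspace F) :=
  (odim V = 0%N -> (n <= edim V)%N) /\
  ((0 < odim V)%N ->
     [pchar F] =i pred0 \/ exists2 p, p \in [pchar F] & (n < p)%N).

(* Main.v *)
(* Expanding a wedge of linear combinations gives a sum over all index maps
   f : 'I_n -> 'I_d. Sorting f shows that its wedge either vanishes, because an
   even index repeats (here char F <> 2 is used), or is plus or minus hat e_I for
   the unique I in hat I_n of which f is a rearrangement; collecting the terms of
   each I produces the superminors. Hence the hat e_I span for every
   parity-ordered basis. For the basis that coordinatises tensors they are also
   free: the antisymmetriser \sum_s sgn(s) s annihilates the relations of the
   exterior power, and its K-th coordinate on the tensor e_I is 0 if K <> I and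
   the order of the stabiliser of I otherwise, a divisor of n! which is 1 when
   V has no odd part. Freeness for the other bases follows by dimension. *)
Require Import Defs.
From mathcomp Require Import all_boot all_fingroup all_algebra.
From mathcomp Require Import zify.

Set Implicit Arguments.
Unset Strict Implicit.
Unset Printing Implicit Defensive.

Import GRing.Theory.
Local Open Scope ring_scope.

(** * Koszul signs *)

Section Koszul.

Variables (F : fieldType) (n : nat).
Implicit Types (p : 'I_n -> bool) (s : 'S_n) (i j : 'I_n).

Lemma koszul_adjacent p i j :
  j = i.+1 :> nat -> koszul F p (tperm i j) = (-1) ^+ (p i && p j).
Proof.
move=> ji; have ij : (i < j)%N by rewrite ji.
rewrite /koszul (big_pred1 (i, j)) // => [[k l]] /=.
rewrite xpair_eqE -!val_eqE /=.
have neq (a b : 'I_n) : a <> b -> (a : nat) <> b by move=> ab /val_inj.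
by case: (tpermP i j k) => [->|->|/neq ki /neq kj];
  case: (tpermP i j l) => [->|->|/neq li /neq lj]; lia.
Qed.

Lemma koszul_sqr p s : koszul F p s * koszul F p s = 1.
Proof.
rewrite /koszul -big_split big1 //= => q _.
by rewrite -expr2 sqrr_sign.
Qed.

(** For constant parities the twist in [koszulM] disappears, so [koszul] is multiplicative; being -1
    on transpositions, it is the sign character. *)
Lemma koszul_odd s : koszul F (fun=> true) s = (-1) ^+ s.
Proof.
have oddM s1 s2 : koszul F (fun=> true) (s1 * s2)%g =
    koszul F (fun=> true) s1 * koszul F (fun=> true) s2 by exact: koszulM.
(* All transpositions are conjugate, so it suffices to look at an adjacent one. *)
have koszul_tperm i j : i != j -> koszul F (fun=> true) (tperm i j) = -1.
  move=> ij; have n1 : (1 < n)%N.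
    by move: (ltn_ord i) (ltn_ord j) ij; rewrite -val_eqE /=; lia.
  pose a := Ordinal (ltnW n1); pose b := Ordinal n1.
  have [g ga gb] : exists2 g : 'S_n, g a = i & g b = j.
    exists (tperm a i * tperm (tperm a i b) j)%g; last by rewrite permM tpermL.
    rewrite permM tpermL [LHS]tpermD 1?eq_sym //.
    by apply/eqP=> e; have := tpermR a i; rewrite {2}e tpermK => /(congr1 val).
  have -> : tperm i j = (g^-1 * (tperm a b * g))%g.
    by rewrite -ga -gb -tpermJ.
  rewrite !oddM mulrCA -oddM mulVg koszul1 mulr1 koszul_adjacent //= expr1.
have [ts -> ts_neq] := prod_tpermP s.
elim: ts ts_neq => [|[i j] ts IH] /=.
  by rewrite big_nil koszul1 odd_perm1.
case/andP=> ij /IH{}IH; rewrite big_cons oddM koszul_tperm //.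
by rewrite IH odd_permM odd_tperm ij signr_addb expr1.
Qed.

Lemma sgn_hat_sqr k s : sgn_hat F k s * sgn_hat F k s = 1.
Proof.
by rewrite /sgn_hat mulrACA koszul_sqr mulr1 -expr2 sqrr_sign.
Qed.

(** Such an [s] preserves the set of positions from [k] on, so every pair it inverts consists of two
    odd positions, as in the all-odd case. *)
Lemma koszul_fix_even k s :
  (forall t : 'I_n, (t < k)%N -> s t = t) ->
  koszul F (fun t => (k <= t)%N) s = (-1) ^+ s.
Proof.
move=> s_fix; rewrite -koszul_odd; apply: eq_bigr => [[a b]] /= /andP[ab sba].
have kP (t : 'I_n) : (k <= t)%N -> (k <= s t)%N.
  apply: contraLR; rewrite -!ltnNge => st_k.
  by rewrite -(@perm_inj _ s _ _ (s_fix _ st_k)).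
case: (leqP k a) => [ka|ak]; first by rewrite (leq_trans ka (ltnW ab)).
have sb_a : (s b < a)%N by rewrite -(s_fix a ak).
case: (leqP k b) => [/kP kb|bk].
  by have := leq_ltn_trans kb (ltn_trans sb_a ak); rewrite ltnn.
by move: sb_a; rewrite s_fix // ltnNge ltnW.
Qed.

End Koszul.

(** * Sorted index maps and their stabilisers *)

Section SortedIndices.

Variables (d0 d1 n : nat).
Local Notation d := (d0 + d1)%N.
Implicit Types (I : {ffun 'I_n -> 'I_d}) (s : 'S_n).

Definition rearr (e : nat) (I : {ffun 'I_n -> 'I_e}) s : {ffun 'I_n -> 'I_e} :=
  [ffun t => I (s t)].

Lemma rearrM e (I : {ffun 'I_n -> 'I_e}) s t :
  rearr (rearr I s) t = rearr I (t * s)%g.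
Proof. by apply/ffunP=> u; rewrite !ffunE permM. Qed.

Lemma rearr1 e (I : {ffun 'I_n -> 'I_e}) : rearr I 1%g = I.
Proof. by apply/ffunP=> t; rewrite ffunE perm1. Qed.

Lemma sort_rearr I :
  exists s, {homo rearr I s : t u / (t <= u)%N}.
Proof.
pose T := [tuple I t | t < n]; pose r := relpre (@nat_of_ord d) leq.
have : perm_eq (sort r T) T by rewrite perm_sort.
case/tuple_permP=> s sE; exists s => t u tu.
have r_tot : total r by move=> x y; apply: leq_total.
have r_tr : transitive r by move=> y x z; apply: leq_trans.
have r_sorted : sorted r (sort r T) by apply: sort_sorted.
have nthE (w : 'I_n) x0 : nth x0 (sort r T) w = rearr I s w.
  by rewrite sE -tnth_nth !tnth_mktuple ffunE.
(* ['I_d] may be empty in general, so the default for [nth] is a value of [I]. *)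
have x0 : 'I_d by exact: (I t).
have := sorted_leq_nth r_tr (fun x => leqnn _) x0 r_sorted.
move=> /(_ t u); rewrite !inE size_sort size_tuple !ltn_ord !nthE.
by apply.
Qed.

(** Two sorted sequences with the same multiset of entries coincide. *)
Lemma homo_rearr_eq I s :
  {homo I : t u / (t <= u)%N} -> {homo rearr I s : t u / (t <= u)%N} ->
  rearr I s = I.
Proof.
move=> I_homo Is_homo; pose r := relpre (@nat_of_ord d) leq.
have r_tr : transitive r by move=> y x z; apply: leq_trans.
have r_anti : antisymmetric r.
  by move=> x y /anti_leq xy; apply: val_inj.
have tuple_sorted (K : {ffun 'I_n -> 'I_d}) :
    {homo K : t u / (t <= u)%N} -> sorted r [tuple K t | t < n].
  move=> K_homo; rewrite sorted_map; apply: (@sub_sorted _ (relpre val leq)).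
    by move=> t u; apply: K_homo.
  by have := iota_sorted 0 n; rewrite -val_enum_ord sorted_map.
have eqT : perm_eq [tuple rearr I s t | t < n] [tuple I t | t < n].
  apply/tuple_permP; exists s; congr val; apply: eq_from_tnth => t.
  by rewrite !tnth_mktuple ffunE.
have := sorted_eq r_tr r_anti (tuple_sorted _ Is_homo) (tuple_sorted _ I_homo) eqT.
move/val_inj => e; apply/ffunP=> t.
by have := congr1 (fun x => tnth x t) e; rewrite !tnth_mktuple.
Qed.

Lemma card_ltn_ord k : (k <= n)%N -> #|[set t : 'I_n | (t < k)%N]| = k.
Proof.
move=> kn; rewrite -[RHS](card_ord k) -(@card_imset _ _ (widen_ord kn)).
  apply: eq_card => t; rewrite inE; apply/idP/imsetP => [tk|[u _ ->]].
    by exists (Ordinal tk) => //; apply: val_inj.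
  by rewrite /= ltn_ord.
by move=> a b /(congr1 val) /= ab; apply: val_inj.
Qed.

Lemma hatI_typeP k I :
  reflect [/\ (k <= minn d0 n)%N, forall t : 'I_n, (I t < d0)%N = (t < k)%N,
            {homo I : t u / (t <= u)%N}
          & forall t u : 'I_n, (t < u)%N -> (u < k)%N -> (I t < I u)%N]
    (I \in hatI_type d0 d1 n k).
Proof.
rewrite inE; apply: (iffP and4P) => [[-> /forallP Ik Ilt Ile]|[-> Ik I_homo Ilt]].
  have {}Ilt (t u : 'I_n) : (t < u)%N -> (u < k)%N -> (I t < I u)%N.
    by move=> tu uk; move/forallP/(_ t)/forallP/(_ u): Ilt; rewrite tu uk.
  have {}Ile (t u : 'I_n) : (k <= t)%N -> (t < u)%N -> (I t <= I u)%N.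
    by move=> kt tu; move/forallP/(_ t)/forallP/(_ u): Ile; rewrite kt tu.
  have {}Ik (t : 'I_n) : (I t < d0)%N = (t < k)%N by rewrite (eqP (Ik t)).
  split=> // t u; rewrite leq_eqVlt => /predU1P[/val_inj -> //|tu].
  case: (ltnP u k) => [uk|ku]; first exact: ltnW (Ilt _ _ tu uk).
  case: (ltnP t k) => [tk|kt]; last exact: Ile.
  by move: (Ik t) (Ik u); lia.
split=> //; first by apply/forallP=> t; rewrite Ik.
  by apply/forallP=> t; apply/forallP=> u; apply/implyP=> /andP[]; apply: Ilt.
apply/forallP=> t; apply/forallP=> u; apply/implyP=> /andP[_ tu].
exact/I_homo/ltnW.
Qed.

Lemma hatIP I :
  reflect ({homo I : t u / (t <= u)%N} /\
           forall t u : 'I_n, (t < u)%N -> (I t < d0)%N -> I t != I u)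
    (I \in hatI d0 d1 n).
Proof.
apply: (iffP bigcupP) => [[k _ /hatI_typeP[_ Ik I_homo Ilt]]|[I_homo I_neq]].
  split=> // t u tu It; apply/eqP=> eqI; have := Ilt _ _ tu.
  by rewrite -Ik -eqI It ltnn => /(_ isT).
pose E := [set t | (I t < d0)%N]; pose k := #|E|.
have kn : (k <= n)%N by rewrite -[leqRHS](card_ord n) max_card.
(* [I] is weakly increasing, so its even entries fill an initial segment, whose length is their
   number [k]. *)
have Ik (t : 'I_n) : (I t < d0)%N = (t < k)%N.
  apply/idP/idP => [It|].
    rewrite -(@card_ltn_ord t.+1 (ltn_ord t)); apply/subset_leq_card.
    apply/subsetP=> u; rewrite !inE ltnS => /I_homo; lia.
  apply: contraLR; rewrite -!leqNgt => It.
  rewrite -(@card_ltn_ord t (ltnW (ltn_ord t))); apply/subset_leq_card.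
  apply/subsetP=> u; rewrite !inE => Iu; rewrite ltnNge.
  by apply/negP=> /I_homo; lia.
have Ilt (t u : 'I_n) : (t < u)%N -> (u < k)%N -> (I t < I u)%N.
  move=> tu uk; have tk : (I t < d0)%N by rewrite Ik; lia.
  by have := I_neq _ _ tu tk; have := I_homo _ _ (ltnW tu); rewrite -val_eqE /=; lia.
(* Strict increase makes each even entry at least its position; were [d0 < k], the entry at position
   [d0] would be both even and at least [d0]. *)
have I_ge m (t : 'I_n) : t = m :> nat -> (t < k)%N -> (t <= I t)%N.
  elim: m t => [|m IH] t tm tk; first by rewrite tm.
  have m_n : (m < n)%N by have := ltn_ord t; lia.
  have := IH (Ordinal m_n) erefl; have := Ilt (Ordinal m_n) t.
  by rewrite /= tm; lia.
have k_min : (k <= minn d0 n)%N.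
  rewrite leq_min kn andbT leqNgt; apply/negP=> d0k.
  have d0n : (d0 < n)%N by lia.
  by have := I_ge _ (Ordinal d0n) erefl d0k; have := Ik (Ordinal d0n); rewrite /= d0k; lia.
by exists (Ordinal (n:=(minn d0 n).+1) k_min) => //; apply/hatI_typeP.
Qed.

(** Ensures that no term of an expansion is collected under two different sorted indices. *)
Lemma rearr_hatI_eq I K s :
  I \in hatI d0 d1 n -> K \in hatI d0 d1 n -> rearr I s = K -> K = I.
Proof.
move=> /hatIP[I_homo _] /hatIP[K_homo _] IsK.
by rewrite -IsK; apply: homo_rearr_eq; rewrite ?IsK.
Qed.

(** [s] keeps even positions even because it preserves the values of [I], and [I] is strictly
    increasing there. *)
Lemma hatI_stab_even k I s (t : 'I_n) :
  I \in hatI_type d0 d1 n k -> rearr I s = I -> (t < k)%N -> s t = t.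
Proof.
move=> /hatI_typeP[_ Ik _ Ilt] /ffunP/(_ t); rewrite ffunE => Ist tk.
have sk : (s t < k)%N by rewrite -Ik Ist Ik.
apply: val_inj; case: (ltngtP (s t) t) => // lt_st.
  by have := Ilt _ _ lt_st tk; rewrite Ist ltnn.
by have := Ilt _ _ lt_st sk; rewrite Ist ltnn.
Qed.

Definition rearr_stab I : {set 'S_n} := [set s | rearr I s == I].

Lemma rearr_stab_group_set I : group_set (rearr_stab I).
Proof.
apply/group_setP; split=> [|s t]; rewrite !inE.
  by rewrite rearr1.
by move=> /eqP Is /eqP It; rewrite -rearrM It Is.
Qed.
Canonical rearr_stab_group I := Group (rearr_stab_group_set I).

Lemma card_rearr_stab_dvd I : (#|rearr_stab I| %| n`!)%N.
Proof.
by rewrite -card_Sn -cardsT; apply: (cardSg (G := [set: 'S_n]%G)); apply: subsetT.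
Qed.

End SortedIndices.

(** In characteristic [p > n] each factor of n! is positive and below [p], hence prime to [p]. *)
Lemma pchar_fact (F : fieldType) n :
  [pchar F] =i pred0 \/ (exists2 p, p \in [pchar F] & (n < p)%N) ->
  n`!%:R != 0 :> F.
Proof.
case=> [char0|[p charFp np]]; first by rewrite ((pcharf0P F).1 char0) -lt0n fact_gt0.
have p_pr := pcharf_prime charFp; rewrite -(dvdn_pcharf charFp) -prime_coprime //.
elim: n np => [|n IH] np; first by rewrite fact0 coprimen1.
rewrite factS coprimeMr IH 1?ltnW // andbT prime_coprime //.
by rewrite gtnNdvd.
Qed.

(** * Expansion of wedges and spanning *)

Section Wedge.

Variables (F : fieldType) (V : superspace F) (n : nat).
Implicit Types (v : (sdim V).-tuple V) (f : {ffun 'I_n -> 'I_(sdim V)}).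

(** Checked on coordinates, where a product of sums distributes over all index maps. The column map
    [J] is the identity in the first claim and a basis index in the second. *)
Lemma wedge_expand v e (A : 'M[F]_(sdim V, e)) (J : {ffun 'I_n -> 'I_e}) :
  wedge (fun t => \sum_i A i (J t) *: tnth v i) =
  \sum_(f : {ffun 'I_n -> 'I_(sdim V)}) (\prod_t A (f t) (J t)) *: hat_e v f.
Proof.
rewrite /wedge /hat_e.
have -> : tens (fun t => \sum_i A i (J t) *: tnth v i) =
    \sum_(f : {ffun 'I_n -> 'I_(sdim V)}) (\prod_t A (f t) (J t)) *: tens (fun t => tnth v (f t)).
  apply/ffunP=> g; rewrite sum_ffunE ffunE.
  transitivity (\prod_t \sum_i
      A i (J t) * coord (homog_basis V) (g t) (tnth v i)).
    apply: eq_bigr => t _; rewrite linear_sum; apply: eq_bigr => i _.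
    by rewrite linearZ.
  rewrite bigA_distr_bigA /=; apply: eq_bigr => f _.
  by rewrite !ffunE /GRing.scale /= -big_split.
by rewrite linear_sum; apply: eq_bigr => f _; rewrite linearZ.
Qed.

Section ParityOrdered.

Variables (v : (sdim V).-tuple V) (v_par : parity_ordered_basis v).

Lemma parity_tnth f t : tnth v (f t) \in spart V (edim V <= f t)%N.
Proof. exact: v_par.2. Qed.

Lemma hat_e_rearr f s : exists c, hat_e v f = c *: hat_e v (rearr f s).
Proof.
eexists; rewrite {1}/hat_e (wedge_perm s^-1%g (parity_tnth f)).
congr (_ *: vquot_pi _ _); apply: tens_ext => t.
by rewrite ffunE invgK.
Qed.

Hypothesis charF2 : 2%N \notin [pchar F].

(** Swapping the two equal even factors negates the wedge without changing it, so its double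
    vanishes. *)
Lemma hat_e_even_repeat f (i j : 'I_n) :
  j = i.+1 :> nat -> f i = f j -> (f i < edim V)%N -> hat_e v f = 0.
Proof.
move=> ji fij fi; have ij : i != j by rewrite -val_eqE /= ji; lia.
have /eqP : hat_e v f = - hat_e v f.
  rewrite {1}/hat_e (wedge_perm (tperm i j) (parity_tnth f)).
  rewrite koszul_adjacent // leqNgt fi /= mulr1 odd_tperm ij expr1 scaleN1r.
  congr (- vquot_pi _ _); apply: tens_ext => t; rewrite tpermV.
  by case: tpermP => [->|->|//]; rewrite fij.
rewrite -addr_eq0 -mulr2n -scaler_nat scaler_eq0 => /orP[two0|/eqP //].
by case/negP: charF2; rewrite inE two0.
Qed.

Lemma hat_e_neq0 f :
  hat_e v f != 0 -> exists2 I, I \in hatIV V n & exists s, f = rearr I s.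
Proof.
move=> f_neq0; have [s g_homo] := sort_rearr f; set g := rearr f s in g_homo.
have fE : f = rearr g s^-1%g.
  by rewrite /g rearrM mulVg rearr1.
exists g; last by exists s^-1%g.
apply/hatIP; split=> // t u tu gt; apply: contraNneq f_neq0 => gtu.
have [c ->] := hat_e_rearr f s; rewrite -/g.
have tn : (t.+1 < n)%N by exact: leq_ltn_trans tu (ltn_ord u).
(* [g] is weakly increasing and [g t = g u] with [t < u], so the repetition already occurs at the
   adjacent position [t.+1]. *)
rewrite (@hat_e_even_repeat g t (Ordinal tn)) ?scaler0 //.
apply/val_inj/eqP; rewrite /= eqn_leq g_homo //= gtu.
exact: g_homo.
Qed.

Lemma span_hat_basis : <<hat_basis n v>>%VS = fullv.
Proof.
apply/eqP; rewrite eqEsubv subvf /=; apply/subvP=> q _.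
have hat_span f : hat_e v f \in <<hat_basis n v>>%VS.
  have [->|/hat_e_neq0[I I_hat [s fE]]] := eqVneq (hat_e v f) 0.
    exact: mem0v.
  have [c ->] := hat_e_rearr f s^-1%g; rewrite fE rearrM mulVg rearr1.
  apply/memvZ/memv_span/mapP; exists (enum_rank_in I_hat I).
    by rewrite mem_enum.
  by rewrite enum_rankK_in.
rewrite -[q]vquot_reprK (tensor_basisE (vquot_repr q)) linear_sum.
apply: memv_suml => f _; rewrite linearZ; apply: memvZ => /=.
(* [A] rewrites the basis that coordinatises tensors in terms of [v]. *)
pose A : 'M[F]_(sdim V) := \matrix_(i, j) coord v i (tnth (homog_basis V) j).
have -> : vquot_pi (ext_rel V n) (tens (fun t => tnth (homog_basis V) (f t))) =
          wedge (fun t => \sum_i A i (f t) *: tnth v i).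
  congr vquot_pi; apply: tens_ext => t.
  rewrite [LHS](coord_basis v_par.1) ?memvf //.
  by apply: eq_bigr => i _; rewrite mxE -tnth_nth.
by rewrite wedge_expand; apply: memv_suml => g _; apply: memvZ.
Qed.

(** Each index map with nonzero wedge lies in exactly one set [rearr I @: S I] with [I] in
    [hatIV V n], and the terms of one such set add up to one superminor. *)
Lemma wedge_superminor S e (A : 'M[F]_(sdim V, e)) (J : {ffun 'I_n -> 'I_e}) :
  (forall I, I \in hatIV V n -> rearrangement_reps I (S I)) ->
  wedge (fun t => \sum_i A i (J t) *: tnth v i) =
  \sum_(I in hatIV V n)
    superminor (edim V) (odim V) (S I) I J A *: hat_e v I.
Proof.
move=> S_reps; rewrite wedge_expand.
pose G f := (\prod_t A (f t) (J t)) *: hat_e v f.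
transitivity (\sum_(I in hatIV V n) \sum_(f in rearr I @: S I) G f); last first.
  apply: eq_bigr => I I_hat; have [S_inj _] := S_reps I I_hat.
  rewrite big_imset //= scaler_suml; apply: eq_bigr => s _.
  have /bigcupP[k _ I_k] := I_hat.
  rewrite (card_even_hatI I_k) (sgn_hatP s v_par I_k) scalerA mulrAC.
  (* The sign in the superminor meets the same sign from reordering [hat_e v I]; their product is
     1. *)
  rewrite sgn_hat_sqr mul1r /G; congr (_ *: _).
  by apply: eq_bigr => t _; rewrite ffunE.
rewrite (exchange_big_dep predT) //=; apply: eq_bigr => f _; rewrite -/(G f).
have [f0|/hat_e_neq0[I I_hat [s fE]]] := eqVneq (hat_e v f) 0.
  by rewrite big1 => [|I _]; rewrite /G f0 scaler0.
rewrite (big_pred1 I) // => K /=; apply/andP/eqP => [[K_hat /imsetP[s' _ fK]]|->].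
  apply: (rearr_hatI_eq (s := (s'^-1 * s)%g)) => //.
  by rewrite -rearrM -fE fK rearrM mulVg rearr1.
split=> //; have [_ /(_ s)[s' s'S eq_s]] := S_reps I I_hat.
by apply/imsetP; exists s' => //; rewrite fE; apply/esym.
Qed.

End ParityOrdered.

(** * Antisymmetrisation and freeness *)

Definition antisym : 'End(tpower V n) := \sum_(s : 'S_n) (-1) ^+ s *: tact s.

Lemma antisymE T : antisym T = \sum_(s : 'S_n) (-1) ^+ s *: tact s T.
Proof.
by rewrite sum_lfunE; apply: eq_bigr => s _; rewrite scale_lfunE.
Qed.

(** Replacing [t] by [s * t] in the sum for [antisym U] gives [antisym (tact s U)] times the sign of
    [s], so the two parts of a generator cancel. *)
Lemma antisym_ext_rel T : T \in ext_rel V n -> antisym T = 0.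
Proof.
move=> /memv_sumP[u uP ->]; rewrite linear_sum big1 // => s _.
have /memv_imgP[U _ ->] := uP s isT.
rewrite add_lfunE opp_lfunE scale_lfunE id_lfunE linearB linearZ /=.
rewrite [in X in _ - X]antisymE scaler_sumr antisymE.
rewrite (reindex_inj (mulgI s)) /= -sumrB big1 // => t _.
by rewrite tactM odd_permM signr_addb scalerA subrr.
Qed.

(** The term of [s] reaches coordinate [K] only if [s^-1] rearranges [I] into [K], which forces
    [K = I] and [s] in the stabiliser. Such an [s] moves only odd positions, so its Koszul sign
    equals its ordinary sign and it contributes 1. *)
Lemma antisym_hat_e I K :
  I \in hatIV V n -> K \in hatIV V n ->
  antisym (tens (fun t => tnth (homog_basis V) (I t))) K =
  if K == I then #|rearr_stab I|%:R else 0.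
Proof.
move=> I_hat K_hat; rewrite antisymE sum_ffunE.
have /bigcupP[k _ I_k] := I_hat; have /hatI_typeP[_ Ik _ _] := I_k.
have termE (s : 'S_n) :
    ((-1) ^+ s *: tact s (tens (fun t => tnth (homog_basis V) (I t)))) K =
    if (K == I) && (s \in rearr_stab I) then 1 else 0 :> F.
  rewrite (tact_homog (p := fun t => (k <= t)%N)); last first.
    by move=> t; rewrite leqNgt -Ik -leqNgt; apply: (homog_basisP V).2.
  rewrite (tens_ext (y := fun t => tnth (homog_basis V) (rearr I s^-1%g t))).
    rewrite tens_basis !ffunE.
    case: eqP => [KE|K_neq]; last first.
      rewrite !scaler0; case: andP => // -[/eqP KI sI]; case: K_neq; rewrite KI.
      by have := groupVr sI; rewrite inE => /eqP.
    have KI : K = I by apply: rearr_hatI_eq (esym KE).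
    have sI : s \in rearr_stab I by rewrite -groupV inE -KE KI.
    rewrite KI eqxx sI koszul_fix_even => [|t tk].
      by rewrite /GRing.scale /= mulr1 -expr2 sqrr_sign.
    by apply: hatI_stab_even I_k _ tk; move: sI; rewrite inE => /eqP.
  by move=> t; rewrite ffunE.
rewrite (eq_bigr _ (fun s _ => termE s)) -big_mkcond /=.
by case: eqP => _; rewrite ?big_pred0_eq // sumr_const.
Qed.

Lemma card_rearr_stab_neq0 I :
  extpow_cond n V -> I \in hatIV V n -> #|rearr_stab I|%:R != 0 :> F.
Proof.
move=> [_ char_odd] I_hat; case: (posnP (odim V)) => [V1|/char_odd/pchar_fact].
  have -> : rearr_stab I = [set 1%g].
    apply/setP=> s; rewrite in_set1; apply/idP/eqP=> [|->]; last exact: group1.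
    have /bigcupP[k _ I_k] := I_hat; have /hatI_typeP[_ Ik _ _] := I_k.
    rewrite inE => /eqP Is; apply/permP=> t; rewrite perm1.
    by apply: hatI_stab_even I_k Is _; rewrite -Ik (leq_trans (ltn_ord _)) // V1 addn0.
  by rewrite cards1 oner_eq0.
apply: contraNneq => stab0; have /dvdnP[m ->] := card_rearr_stab_dvd I.
by rewrite natrM stab0 mulr0.
Qed.

Lemma free_homog_hat_basis :
  extpow_cond n V -> free (hat_basis n (homog_basis V)).
Proof.
move=> n_cond; apply/freeP => k; set T := \sum_i k i *: tens (fun t =>
  tnth (homog_basis V) (enum_val i t)) : tpower V n.
have -> : \sum_i k i *: (hat_basis n (homog_basis V))`_i = vquot_pi (ext_rel V n) T.
  rewrite linear_sum; apply: eq_bigr => i _; rewrite linearZ -tnth_nth.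
  by rewrite tnth_mktuple.
(* [antisym] kills [T], while its coordinate at [enum_val i] is [k i] times a nonzero stabiliser
   order. *)
move/eqP; rewrite vquot_pi_eq0 => /antisym_ext_rel/ffunP T0 i.
have := T0 (enum_val i); rewrite linear_sum sum_ffunE (bigD1 i) //= big1.
  rewrite linearZ !ffunE antisym_hat_e ?enum_valP // eqxx addr0.
  move/eqP; rewrite scaler_eq0 (negPf (card_rearr_stab_neq0 _ _)) ?enum_valP //.
  by rewrite orbF => /eqP.
move=> j ji; rewrite linearZ !ffunE antisym_hat_e ?enum_valP //.
by rewrite (inj_eq enum_val_inj) eq_sym (negPf ji) scaler0.
Qed.

(** A spanning family with as many members as the basis from [homog_basis V] is itself a basis. *)
Lemma hat_basisP v :
  2%N \notin [pchar F] -> extpow_cond n V -> parity_ordered_basis v ->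
  basis_of fullv (hat_basis n v).
Proof.
move=> charF2 n_cond v_par; rewrite basisEdim span_hat_basis // subvv size_tuple.
have hom_basis : basis_of fullv (hat_basis n (homog_basis V)).
  rewrite basisEfree free_homog_hat_basis // subvf /=.
  by rewrite -(span_hat_basis (homog_basisP V)) // dim_span.
by rewrite (size_basis hom_basis) leqnn.
Qed.

End Wedge.

(** * Vanishing superminors and the two formulas *)

Lemma superminor_eq0 (F : fieldType) d0 d1 n e e0
    (A : 'M[F]_(d0 + d1, e)) (S : {set 'S_n})
    (I : {ffun 'I_n -> 'I_(d0 + d1)}) (J : {ffun 'I_n -> 'I_e}) :
  even_supermx d0 e0 A ->
  #|[set t | (I t < d0)%N]| != #|[set t | (J t < e0)%N]| ->
  superminor d0 d1 S I J A = 0.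
Proof.
move=> A_even neq; rewrite /superminor big1 // => s _.
(* If all parities matched, [s] would carry the even columns bijectively to the even rows, against
   the unequal counts; so some factor lies off the diagonal blocks. *)
have [/forallP e_par|/forallPn[t t_par]] :=
    boolP [forall t, (I (s t) < d0)%N == (J t < e0)%N].
  case/eqP: neq; rewrite -(card_preimset _ (@perm_inj _ s)).
  by apply: eq_card => t; rewrite !inE (eqP (e_par t)).
by rewrite (bigD1 t) //= A_even // mul0r mulr0.
Qed.

Theorem proposition5p11 (F : fieldType) (n : nat) (V V' : superspace F)
    (v : (sdim V).-tuple V) (v' : (sdim V').-tuple V')
    (S : {ffun 'I_n -> 'I_(sdim V)} -> {set 'S_n})
    (S' : {ffun 'I_n -> 'I_(sdim V')} -> {set 'S_n}) :
  2%N \notin [pchar F] -> (2 <= n)%N ->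
  (fullv : {vspace V}) != 0%VS -> (fullv : {vspace V'}) != 0%VS ->
  extpow_cond n V -> extpow_cond n V' ->
  parity_ordered_basis v -> parity_ordered_basis v' ->
  (forall I, I \in hatIV V n -> rearrangement_reps I (S I)) ->
  (forall I, I \in hatIV V' n -> rearrangement_reps I (S' I)) ->
  (basis_of fullv (hat_basis n v) /\ basis_of fullv (hat_basis n v')) /\
  (forall (r : nat) (w : 'I_n -> V) (A : 'M[F]_(sdim V, n)),
     (r <= minn (edim V) n)%N ->
     (forall j : 'I_n, w j \in spart V (r <= j)%N) ->
     (forall j : 'I_n, w j = \sum_i A i j *: tnth v i) ->
     let J : {ffun 'I_n -> 'I_n} := [ffun j => j] in
     [/\ even_supermx (edim V) r A,
         wedge w =
           \sum_(I in hatIV V n)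
             superminor (edim V) (odim V) (S I) I J A *: hat_e v I
       & forall I, I \in hatIV V n ->
           I \notin hatI_type (edim V) (odim V) n r ->
           superminor (edim V) (odim V) (S I) I J A = 0]) /\
  (forall h : 'Hom(V, V'), even_hom h ->
     let A := coordmx v v' h in
     [/\ even_supermx (edim V') (edim V) A,
         coordmx (hat_basis n v) (hat_basis n v') (extpow_map n h) =
           extpow_mx S' A
       & forall (r s : nat) I I',
           I \in hatI_type (edim V) (odim V) n r ->
           I' \in hatI_type (edim V') (odim V') n s -> r != s ->
           superminor (edim V') (odim V') (S' I') I' I A = 0]).
Proof.
move=> charF2 _ _ _ n_cond n_cond' v_par v'_par S_reps S'_reps.
have v'_basis := hat_basisP charF2 n_cond' v'_par.
split; [split=> //; exact: hat_basisP|split].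
  move=> r w A r_le w_par wE J.
  have v_free := basis_free v_par.1.
  have A_even : even_supermx (edim V) r A.
    (* [v] is free, so [A i j] is a coordinate of the homogeneous vector [w j] and vanishes at the
       other parity. *)
    move=> i j ij; rewrite -(coord_sum_free (fun i => A i j) i v_free).
    have <- : w j = \sum_(i < sdim V) A i j *: v`_i.
      by rewrite wE; apply: eq_bigr => k _; rewrite -tnth_nth.
    by apply: coord_homog (w_par j) _ => //; rewrite leqNgt (leqNgt r) (inj_eq negb_inj).
  split=> //.
    rewrite -(wedge_superminor v_par charF2) //; congr vquot_pi.
    by apply: tens_ext => t; rewrite wE ffunE.
  move=> I /bigcupP[k _ I_k] I_r; apply: superminor_eq0 A_even _.
  rewrite (card_even_hatI I_k); have -> : #|[set t | (J t < r)%N]| = r.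
    move: r_le; rewrite leq_min => /andP[_ rn]; rewrite -[RHS](card_ltn_ord rn).
    by apply: eq_card => t; rewrite !inE ffunE.
  by apply: contraNneq I_r => <-.
move=> h h_even A.
have A_even : even_supermx (edim V') (edim V) A.
  move=> i j ij; rewrite mxE; have hj := memv_img h (v_par.2 j).
  apply: coord_homog (subvP (h_even _) _ hj) _ => //.
  by rewrite leqNgt (leqNgt (edim V)) (inj_eq negb_inj).
split=> //.
  apply/matrixP=> i j; rewrite !mxE tnth_mktuple extpow_map_wedge //.
  (* The image of a basis wedge is the wedge of the columns of [A] selected by [enum_val j], which
     serves as the column map. *)
  have -> : wedge (fun t => h (tnth v (enum_val j t))) =
            wedge (fun t => \sum_i A i (enum_val j t) *: tnth v' i).
    congr vquot_pi; apply: tens_ext => t.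
    rewrite [LHS](coord_basis v'_par.1) ?memvf //.
    by apply: eq_bigr => k _; rewrite mxE -tnth_nth.
  rewrite (wedge_superminor v'_par charF2 _ _ S'_reps) big_enum_val /=.
  rewrite -[RHS](coord_sum_free (fun i => superminor (edim V') (odim V')
    (S' (enum_val i)) (enum_val i) (enum_val j) A) i (basis_free v'_basis)).
  congr coord; apply: eq_bigr => k _.
  by rewrite -tnth_nth tnth_mktuple.
move=> r s I I' I_r I'_s rs; apply: superminor_eq0 A_even _.
by rewrite (card_even_hatI I_r) (card_even_hatI I'_s) eq_sym.
Qed.
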